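(* Let $S$ be a set of triangles satisfying Condition ( * ) such that $Forb_c(S)$ is a prioritised semi-free amalgamation class with respect to the linearly ordered $\mathcal L'=\{R_1>\dots>R_m\}\subsetneq\mathcal L$, and let $\mathcal M_S$ be its Fraïssé limit. Then for every non-trivial $g\in\mathrm{Aut}(\mathcal M_S)$ there exist $k,h\in\mathrm{Aut}(\mathcal M_S)$ such that $[k,[h,g]]$ moves almost maximally.
   Context: $\mathcal L$ is a language of binary relation symbols interpreted as symmetric irreflexive relations; a structure is complete if any two distinct elements $a,b$ are related by exactly one relation, denoted $\mathbf r(a,b)$. A triangle is a complete structure on three points, specified by the multiset of its edge relations. $Forb_c(S)$ is the class of finite complete structures embedding no triangle of $S$, assumed to be an amalgamation class; $\mathcal M_S$ is its Fraïssé limit. $AB$ denotes the substructure on $A\cup B$, $aB=\{a\}\cup B$. For $A,B,C\in Forb_c(S)$ with $B$ common substructure of $A,C$, $A\otimes_B C$ is the complete structure on the disjoint union of $A,C$ over $B$ extending both, with $\mathbf r(a,c)=R_i$ for $a\in A\setminus B$, $c\in C\setminus B$, where $i$ is least such that no $b\in B$ makes the triangle with edges $\mathbf r(a,b),\mathbf r(b,c),R_i$ lie in $S$ ($R_1$ if $B=\emptyset$). Prioritised semi-free amalgamation class: $A\otimes_B C$ is always defined and in $Forb_c(S)$. $A\mathrel{\perp\!\!\!\perp}_B C$ means the substructure of $\mathcal M_S$ on $A\cup B\cup C$ equals $AB\otimes_B BC$. Condition ( * ): (i) $S$ contains no triangle having two edges coloured $R_1,R_1$ or $R_1,R_2$;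 (ii) for all $a,b,c\in\mathcal M_S$ and finite $B$, if $a\mathrel{\perp\!\!\!\perp}_{bB}c$ and $\mathbf r(a,b)\in\mathcal L'$ then $a\mathrel{\perp\!\!\!\perp}_B c$. A 1-type over finite $X$ is an orbit of a single element under the pointwise stabiliser of $X$ in $\mathrm{Aut}(\mathcal M_S)$; its elements are its realisations. An automorphism $g$ moves almost maximally if every 1-type over every finite set $X$ has a realisation $a$ with $a\mathrel{\perp\!\!\!\perp}_X ga$. $[h,g]=h^{-1}g^{-1}hg$. *)

(* Defs.v *)
From mathcomp Require Import all_boot.
From mathcomp Require Import boolp classical_sets functions cardinality.

Set Implicit Arguments.
Unset Strict Implicit.
Unset Printing Implicit Defensive.

Local Open Scope classical_set_scope.

(* [edge P a b] says that the relation symbol P : L holds of a and b. *)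
Record structure (L : Type) := Structure {
  carrier :> Type;
  edge : L -> carrier -> carrier -> Prop;
  edge_sym : forall P a b, edge P a b -> edge P b a;
  edge_irr : forall P a, ~ edge P a a }.

Arguments edge {L s} _ _ _.

(* In a complete structure the unique P with [edge P a b] is r(a,b);
   "r(a,b) = P" is always written [edge P a b]. *)
Definition complete (L : Type) (A : structure L) : Prop :=
  forall a b : A, a <> b -> exists! P, edge P a b.

Definition embedding (L : Type) (A D : structure L) (f : A -> D) : Prop :=
  injective f /\ forall P a b, edge P a b <-> edge P (f a) (f b).

Definition embeds (L : Type) (A D : structure L) : Prop :=
  exists f : A -> D, embedding f.

Definition substructure (L : Type) (M : structure L) (X : set M) :
    structure L :=
  @Structure L {x : M | X x} (fun P a b => edge P (sval a) (sval b))
    (fun P a b => @edge_sym L M P (sval a) (sval b))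
    (fun P a => @edge_irr L M P (sval a)).

Definition inclusion (L : Type) (M : structure L) (X Y : set M)
    (XY : X `<=` Y) (x : substructure X) : substructure Y :=
  exist _ (sval x) (XY (sval x) (svalP x)).

(* A set of 3-element multisets of relation symbols: a ternary predicate that
   is invariant under all permutations of its arguments. *)
Record triangles (L : Type) := Triangles {
  in_triangles :> L -> L -> L -> Prop;
  triangles_swap12 : forall P Q R, in_triangles P Q R -> in_triangles Q P R;
  triangles_swap23 : forall P Q R, in_triangles P Q R -> in_triangles P R Q }.

(* The three points are automatically distinct, edges being irreflexive. *)
Definition embeds_triangle (L : Type) (P Q R : L) (A : structure L) : Prop :=
  exists a b c : A, [/\ edge P a b, edge Q b c & edge R a c].

Definition Forbc (L : Type) (S : triangles L) (A : structure L) : Prop :=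
  [/\ finite_set [set: A], complete A &
      forall P Q R, S P Q R -> ~ embeds_triangle P Q R A].

Definition amalgamation_class (L : Type) (K : structure L -> Prop) : Prop :=
  [/\ forall A B, K A -> embeds B A -> K B,
      forall A C, K A -> K C -> exists D, [/\ K D, embeds A D & embeds C D] &
      forall (A B C : structure L) (f : B -> A) (g : B -> C),
        K A -> K B -> K C -> embedding f -> embedding g ->
        exists (D : structure L) (i : A -> D) (j : C -> D),
          [/\ K D, embedding i, embedding j & forall b, i (f b) = j (g b)]].

(* Here B is a common substructure of A and C through f and g.  The list
   R 0, R 1, ... enumerates L' by decreasing priority, so that R 0 is the
   relation called R_1 in the usual 1-based notation. *)
Definition allowed (L : Type) (S : triangles L) (A B C : structure L)
    (f : B -> A) (g : B -> C) (a : A) (c : C) (P : L) : Prop :=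
  forall b Q Q', edge Q a (f b) -> edge Q' (g b) c -> ~ S Q Q' P.

Definition first_allowed (L : Type) (S : triangles L) (m : nat) (R : 'I_m -> L)
    (A B C : structure L) (f : B -> A) (g : B -> C) (a : A) (c : C)
    (k : 'I_m) : Prop :=
  allowed S f g a c (R k) /\
  forall l : 'I_m, l < k -> ~ allowed S f g a c (R l).

(* D, with i and j, is (a copy of) the amalgam of A and C over B; this
   determines D up to a unique isomorphism commuting with i and j. *)
Definition semifree_amalgam (L : Type) (S : triangles L) (m : nat)
    (R : 'I_m -> L) (A B C : structure L) (f : B -> A) (g : B -> C)
    (D : structure L) (i : A -> D) (j : C -> D) : Prop :=
  [/\ complete D,
      embedding i /\ embedding j,
      (forall d, range i d \/ range j d),
      (forall b, i (f b) = j (g b)) /\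
        (forall a c, i a = j c -> exists b, a = f b /\ c = g b) &
      forall a c, ~ range f a -> ~ range g c ->
        exists2 k, first_allowed S R f g a c k & edge (R k) (i a) (j c)].

Definition prioritised_semifree (L : Type) (S : triangles L) (m : nat)
    (R : 'I_m -> L) : Prop :=
  amalgamation_class (Forbc S) /\
  forall (A B C : structure L) (f : B -> A) (g : B -> C),
    Forbc S A -> Forbc S B -> Forbc S C -> embedding f -> embedding g ->
    exists (D : structure L) (i : A -> D) (j : C -> D),
      semifree_amalgam S R f g i j /\ Forbc S D.

Lemma subset_UUr (T : Type) (A B C : set T) : B `|` C `<=` A `|` B `|` C.
Proof. by rewrite -setUA; exact: subsetUr. Qed.

Definition indep (L : Type) (S : triangles L) (m : nat) (R : 'I_m -> L)
    (M : structure L) (A B C : set M) : Prop :=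
  semifree_amalgam S R
    (inclusion (@subsetUr M A B)) (inclusion (@subsetUl M B C))
    (inclusion (@subsetUl M (A `|` B) C)) (inclusion (@subset_UUr M A B C)).

Record aut (L : Type) (M : structure L) := Aut {
  aut_fun :> M -> M;
  aut_invfun : M -> M;
  aut_funK : cancel aut_fun aut_invfun;
  aut_invfunK : cancel aut_invfun aut_fun;
  aut_edge : forall P a b, edge P (aut_fun a) (aut_fun b) <-> edge P a b }.

Lemma aut_inv_edge (L : Type) (M : structure L) (g : aut M) P a b :
  edge P (aut_invfun g a) (aut_invfun g b) <-> edge P a b.
Proof. by rewrite -(aut_edge g) !aut_invfunK. Qed.

Definition aut_inv (L : Type) (M : structure L) (g : aut M) : aut M :=
  Aut (aut_invfunK g) (aut_funK g) (aut_inv_edge g).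

Lemma aut_mul_edge (L : Type) (M : structure L) (g h : aut M) P a b :
  edge P ((g \o h) a) ((g \o h) b) <-> edge P a b.
Proof. by rewrite /= !aut_edge. Qed.

Definition aut_mul (L : Type) (M : structure L) (g h : aut M) : aut M :=
  Aut (can_comp (aut_funK g) (aut_funK h))
    (can_comp (aut_invfunK h) (aut_invfunK g)) (aut_mul_edge g h).

Definition aut_comm (L : Type) (M : structure L) (h g : aut M) : aut M :=
  aut_mul (aut_inv h) (aut_mul (aut_inv g) (aut_mul h g)).

Definition fraisse_limit (L : Type) (K : structure L -> Prop)
    (M : structure L) : Prop :=
  [/\ countable [set: M],
      forall A, K A <-> finite_set [set: A] /\ embeds A M &
      forall (X : set M) (f : substructure X -> M),
        finite_set X -> embedding f ->
        exists g : aut M, forall x, g (sval x) = f x].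

(* In the second clause the proviso [b <> c] is implicit in the mathematics:
   a is always independent from b over bB, so for c = b the condition would
   say that a and b are independent over every finite B as soon as r(a,b) is
   in L', which fails for B empty and r(a,b) = R_2. *)
Definition condition_star (L : Type) (S : triangles L) (m : nat)
    (R : 'I_m -> L) (M : structure L) : Prop :=
  (forall (i j : 'I_m) (P : L), i = 0 :> nat -> j <= 1 -> ~ S (R i) (R j) P) /\
  (forall (a b c : M) (B : set M), finite_set B -> b <> c ->
     indep S R [set a] (b |` B) [set c] -> (exists i, edge (R i) a b) ->
     indep S R [set a] B [set c]).

Definition orbit_over (L : Type) (M : structure L) (X : set M) (x : M) : set M :=
  [set y | exists2 f : aut M, (forall z, X z -> f z = z) & f x = y].

Definition type1 (L : Type) (M : structure L) (X p : set M) : Prop :=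
  exists x, p = orbit_over X x.

Definition moves_almost_maximally (L : Type) (S : triangles L) (m : nat)
    (R : 'I_m -> L) (M : structure L) (g : aut M) : Prop :=
  forall X p : set M, finite_set X -> type1 X p ->
    exists2 a, p a & indep S R [set a] X [set g a].

(* Main.v *)
(** Independence of A and C over B only concerns pairs of points, and a pair
    that is independent over B stays independent over any larger base.  Call T
    a set of relations such that every non-algebraic type over a finite set has
    a realisation b with r(b, g b) in T.  A back-and-forth construction gives h
    for which every non-algebraic type over X has a realisation a such that,
    with e = g a, d = [h, g] a and D the (finite) domain of h built so far,
    a and d are independent over e D, r(a, z) is in L' for z in D \ X, and
    r(a, e), r(d, e) are in T: one lets h e be a realisation b of the required
    type with r(b, g b) in T, and then chooses the preimage d of g^-1 b
    independent from a.
    - For non-trivial g one may take for T the set of all relations, because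
      no triangle of S has two edges R_1, R_1 or R_1, R_2; then
      r(a, [h, g] a) is in L', being the relation of an independent pair.
    - So for [h, g] one may take T = L', and clause (ii) of Condition (star)
      removes e and the points of D \ X from the base. *)
Require Import Defs.
From mathcomp Require Import all_boot.
From mathcomp Require Import boolp classical_sets functions cardinality.

Local Open Scope classical_set_scope.

Lemma finite_set_rec (T : Type) (P : set T -> Prop) :
  P set0 -> (forall x A, finite_set A -> P A -> P (x |` A)) ->
  forall A, finite_set A -> P A.
Proof.
elim/Pchoice: T => T in P *; move=> P0 PU A /finite_seqP[s ->].
elim: s => [|x s IH]; first by rewrite (_ : [set` _] = set0) //;
  apply/seteqP; split.
suff -> : [set` x :: s] = x |` [set` s] by apply: PU.
by apply/seteqP; split=> y /=; rewrite inE; [move/orP => [/eqP|]; [left|right]|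
  move=> [->|->]; rewrite ?eqxx ?orbT].
Qed.

(** * Types and partial isomorphisms in a structure *)

Section Structures.
Set Implicit Arguments.
Unset Strict Implicit.
Context {L : Type} {S : triangles L} {M : structure L}.

Lemma edge_neq P (a b : M) : edge P a b -> a <> b.
Proof. by move=> + ab; rewrite ab; exact: edge_irr. Qed.

Lemma finite_substructure (X : set M) :
  finite_set X -> finite_set [set: substructure X].
Proof.
move=> Xfin.
have -> : [set: substructure X] = (fun u => sval u) @^-1` X.
  by apply/seteqP; split=> // u _; exact: svalP.
by apply: finite_preimage => // u v _ _; exact: eq_sig_hprop.
Qed.

Lemma embedding_sval (X : set M) :
  embedding (fun u : substructure X => sval u).
Proof. by split=> // u v; exact: eq_sig_hprop. Qed.

Lemma embedding_inclusion (X Y : set M) (XY : X `<=` Y) :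
  embedding (inclusion XY).
Proof.
by split=> // u v uv; apply: eq_sig_hprop => //; move: uv => [].
Qed.

(** Quantifier-free form of lying in one orbit over [X]; for finite [X] in the limit the two agree,
    by homogeneity. *)
Definition same_type (X : set M) (x a : M) :=
  forall z, X z -> forall P, edge P x z <-> edge P a z.

Lemma same_type_trans X Y x y z :
  X `<=` Y -> same_type X x y -> same_type Y y z -> same_type X x z.
Proof. by move=> XY xy yz u Xu P; rewrite xy// yz//; exact: XY. Qed.

(** Functionality and injectivity come from preservation of edges: in a complete structure two
    points are equal exactly when no relation holds between them. *)
Definition partial_iso (s : set (M * M)) :=
  forall u v, s u -> s v -> forall P, edge P u.1 v.1 <-> edge P u.2 v.2.

Definition graph (g : aut M) : set (M * M) := [set u | g u.1 = u.2].

Lemma partial_iso_graph (g : aut M) s : s `<=` graph g -> partial_iso s.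
Proof. by move=> sg u v /sg <- /sg <- P; rewrite aut_edge. Qed.

Lemma partial_isoU s x y : partial_iso s ->
  (forall u, s u -> forall P, edge P x u.1 <-> edge P y u.2) ->
  partial_iso ((x, y) |` s).
Proof.
move=> sP xy u v [->|su] [->|sv] P //=.
- by split=> E; case: (edge_irr E).
- exact: xy.
- by split=> E; apply/edge_sym/(xy _ su)/edge_sym.
- exact: sP.
Qed.

(** * Completeness, omitted triangles and homogeneity of the limit *)

Context (MS : fraisse_limit (Forbc S) M).

Lemma Forbc_substructure (X : set M) :
  finite_set X -> Forbc S (substructure X).
Proof.
move=> Xfin; have [_ KP _] := MS; apply/KP; split.
  exact: finite_substructure.
by exists (fun u => sval u); exact: embedding_sval.
Qed.

Lemma limit_complete : complete M.
Proof.
move=> a b ab; pose X := [set a; b].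
have [_ Xc _] := Forbc_substructure (finite_set2 a b).
have Xa : X a by left.
have Xb : X b by right.
have [|P [Pab Pu]] := Xc (exist _ a Xa) (exist _ b Xb); first by case.
by exists P; split.
Qed.

Lemma edge_ex (a b : M) : a <> b -> exists P, edge P a b.
Proof. by move=> /limit_complete[P [? _]]; exists P. Qed.

Lemma edge_inj P Q (a b : M) : edge P a b -> edge Q a b -> P = Q.
Proof.
move=> Pab Qab; have [U [_ Uu]] := limit_complete (edge_neq Pab).
by rewrite -(Uu _ Pab) (Uu _ Qab).
Qed.

Lemma limit_triangle P Q U (a b c : M) :
  edge P a b -> edge Q b c -> edge U a c -> ~ S P Q U.
Proof.
move=> Pab Qbc Uac PQU; pose X := [set a; b] `|` [set c].
have Xfin : finite_set X.
  by rewrite finite_setU; split; first exact: finite_set2.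
have [_ _ /(_ _ _ _ PQU)] := Forbc_substructure Xfin; apply.
have Xa : X a by left; left.
have Xb : X b by left; right.
have Xc : X c by right.
by exists (exist _ a Xa), (exist _ b Xb), (exist _ c Xc).
Qed.

(** If [a] were in [X], the relation between [x] and [a] would transfer to a loop at [a]. *)
Lemma same_type_notin X x a : ~ X x -> same_type X x a -> ~ X a.
Proof.
move=> Xx xa Xa; have [|P] := @edge_ex x a; first by move=> E; rewrite E in Xx.
by move=> /(xa a Xa); exact: edge_irr.
Qed.

Lemma homogeneity s : finite_set s -> partial_iso s ->
  exists g : aut M, s `<=` graph g.
Proof.
move=> sfin sP; pose X := fst @` s.
have Xfin : finite_set X by exact: finite_image.
have /choice[f fP] : forall u : substructure X, exists y, s (sval u, y).
  by case=> x /= Xx; case: (Xx) => -[x' y] sxy /= <-; exists y.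
have fe P u v : edge P u v <-> edge P (f u) (f v).
  exact: sP _ _ (fP u) (fP v) P.
have [_ _ MH] := MS.
have [|g gf] := MH X f Xfin.
  split=> // u v fuv; apply: contrapT => uv.
  have [|P] := @edge_ex (sval u) (sval v).
    by move=> E; apply: uv; exact: eq_sig_hprop.
  by move=> /(fe P u v); rewrite fuv; exact: edge_irr.
exists g => -[x y] sxy; rewrite /graph /=.
have Xx : X x by exists (x, y).
have /= -> := gf (exist _ x Xx).
have /= sfx := fP (exist _ x Xx).
apply: contrapT => /edge_ex[P].
by move=> /(sP _ _ sfx sxy P); exact: edge_irr.
Qed.

Lemma same_type_aut X x a : finite_set X -> same_type X x a ->
  exists2 f : aut M, (forall z, X z -> f z = z) & f x = a.
Proof.
move=> Xfin xa; pose s := [set (z, z) | z in X].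
have sfin : finite_set s by exact: finite_image.
have sP : partial_iso s by move=> u v [? _ <-] [? _ <-].
have [||f fP] := @homogeneity ((x, a) |` s).
- by rewrite finite_setU; split.
- by apply: partial_isoU => // u [z Xz <-] P; exact: xa.
exists f; last by apply: (fP (x, a)); left.
by move=> z Xz; apply: (fP (z, z)); right; exists z.
Qed.

(** * One-point extensions of finite sets *)

Section OnePoint.
Context (X : set M) (q : M -> L -> Prop).

Definition one_point_edge P (u v : option (substructure X)) : Prop :=
  match u, v with
  | Some u, Some v => edge P u v
  | Some u, None | None, Some u => q (sval u) P
  | None, None => False
  end.

Lemma one_point_sym P u v : one_point_edge P u v -> one_point_edge P v u.
Proof. by case: u v => [u|] [v|] //=; exact: edge_sym. Qed.

Lemma one_point_irr P u : ~ one_point_edge P u u.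
Proof. by case: u => [u|] //=; exact: edge_irr. Qed.

Definition one_point : structure L := Structure one_point_sym one_point_irr.

(** The structure on [X] and a new point [None], related to [z] as [q] prescribes, lies in the
    class, hence embeds in [M]; homogeneity carries the embedded copy of [X] back onto [X], and the
    new point with it. *)
Lemma realise : finite_set X ->
  (forall z, X z -> exists! P, q z P) ->
  (forall z z' P Q P', X z -> X z' -> q z P -> edge Q z z' -> q z' P' ->
    ~ S P Q P') ->
  exists2 a, ~ X a & forall z P, X z -> edge P a z <-> q z P.
Proof.
move=> Xfin qu qS.
have : Forbc S one_point.
  have [Xf Xc XS] := Forbc_substructure Xfin.
  split.
  - have -> : [set: one_point] = None |` (Some @` [set: substructure X]).
      apply/seteqP; split=> // -[u|] _; last by left.
      by right; exists u.
    by rewrite finite_setU; split=> //; exact: finite_image.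
  - move=> [u|] [v|] //= uv.
    + by apply: Xc => E; apply: uv; rewrite E.
    + exact: qu (svalP u).
    + exact: qu (svalP v).
  - move=> P Q U PQU [[a|] [[b|] [[c|] [/= ab bc ac]]]] //.
    + by apply: (XS _ _ _ PQU); exists a, b, c.
    + apply: (qS _ _ _ _ _ (svalP a) (svalP b) ac ab bc).
      exact/triangles_swap12/triangles_swap23.
    + by apply: (qS _ _ _ _ _ (svalP a) (svalP c) ab ac bc);
        exact/triangles_swap23.
    + exact: (qS _ _ _ _ _ (svalP b) (svalP c) ab bc ac).
have [_ KP MH] := MS => /KP[_ [e [einj eP]]].
have [|g gP] := MH X (fun u => e (Some u)) Xfin.
  by split=> [u v /einj[]//|P u v]; rewrite -eP.
have ge P z (Xz : X z) : edge P (aut_invfun g (e None)) z <-> q z P.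
  rewrite -(aut_edge g) aut_invfunK (gP (exist _ z Xz)).
  by rewrite -eP.
exists (aut_invfun g (e None)); last by move=> z P; exact: ge.
move=> Xa; have [P [qP _]] := qu _ Xa.
by case: (edge_irr ((ge P _ Xa).2 qP)).
Qed.

End OnePoint.

(** * Independence of two points over a base *)

Section Independence.
Context {m : nat} {R : 'I_m -> L}.

Definition free_edge (a c : M) := exists k, edge (R k) a c.

Definition permitted (X : set M) (a c : M) P :=
  forall b Q Q', X b -> edge Q a b -> edge Q' b c -> ~ S Q Q' P.

Definition pindep (X : set M) (a c : M) := exists k : 'I_m,
  [/\ permitted X a c (R k), forall l : 'I_m, l < k -> ~ permitted X a c (R l) &
      edge (R k) a c].

Lemma pindep_free X a c : pindep X a c -> free_edge a c.
Proof. by case=> k [_ _ ?]; exists k. Qed.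

Lemma permitted_sym X a c P : permitted X a c P -> permitted X c a P.
Proof.
move=> acP b Q Q' Xb cb ba QQ'.
exact: acP b Q' Q Xb (edge_sym ba) (edge_sym cb) (triangles_swap12 QQ').
Qed.

Lemma pindep_sym X a c : pindep X a c -> pindep X c a.
Proof.
case=> k [kP kmin ac]; exists k; split; first exact: permitted_sym.
- by move=> l /kmin + lP; apply; exact: permitted_sym.
- exact: edge_sym.
Qed.

(** Relations of higher priority are already blocked by [X], and the actual relation of [a] and [c]
    is never blocked, since [M] omits the triangles of [S]. *)
Lemma pindepS X Y a c : X `<=` Y -> pindep X a c -> pindep Y a c.
Proof.
move=> XY [k [kP kmin ac]]; exists k; split => //.
- by move=> b Q Q' _ ab bc; exact: limit_triangle ab bc ac.
- by move=> l /kmin + lP; apply=> b Q Q' /XY; exact: lP.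
Qed.

Lemma indepP (X : set M) a c : ~ X a -> ~ X c ->
  indep S R [set a] X [set c] <-> pindep X a c.
Proof.
move=> Xa Xc.
pose f := inclusion (@subsetUr M [set a] X).
pose h := inclusion (@subsetUl M X [set c]).
have allowedE (u : substructure ([set a] `|` X))
    (v : substructure (X `|` [set c])) P :
    allowed S f h u v P <-> permitted X (sval u) (sval v) P.
  split=> [uv b Q Q' Xb|uv [b Xb] Q Q']; last exact: uv.
  exact: uv (exist _ b Xb) Q Q'.
have la : ([set a] `|` X) a by left.
have lc : (X `|` [set c]) c by right.
split.
  case=> _ _ _ _ /(_ (exist _ a la) (exist _ c lc))[].
  - by move=> [[b Xb] _ [E]]; rewrite E in Xb.
  - by move=> [[b Xb] _ [E]]; rewrite E in Xb.
  move=> k [/allowedE kP kmin] ac; exists k; split=> // l lk lP.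
  by apply: (kmin l lk); exact/allowedE.
move=> ac; split.
- move=> [u Du] [v Dv] uv; have [E|P [Puv Pu]] := @limit_complete u v.
    by apply: uv; exact: eq_sig_hprop.
  by exists P; split.
- by split; exact: embedding_inclusion.
- move=> [d Dd]; have [Ad|Cd] : ([set a] `|` X) d \/ (X `|` [set c]) d.
    by case: Dd => [|]; [left|right; right].
  + by left; exists (exist _ d Ad) => //; exact: eq_sig_hprop.
  + by right; exists (exist _ d Cd) => //; exact: eq_sig_hprop.
- split=> [b|[u Au] [v Cv] [/= uv]]; first exact: eq_sig_hprop.
  have Xu : X u.
    case: Au => [/= ua|//]; case: Cv => [Xv|/= vc]; first by rewrite uv.
    by case: ac => k [_ _ /edge_neq]; rewrite -ua -vc.
  exists (exist _ u Xu); split; apply: eq_sig_hprop => //=.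
- move=> [u Au] [v Cv] uX vX.
  have ua : u = a.
    case: Au uX => // Xu uX; case: uX.
    by exists (exist _ u Xu) => //; exact: eq_sig_hprop.
  have vc : v = c.
    case: Cv vX => // Xv vX; case: vX.
    by exists (exist _ v Xv) => //; exact: eq_sig_hprop.
  case: ac => k [kP kmin ac]; exists k; last by rewrite /= ua vc.
  split; first by apply/allowedE; rewrite /= ua vc.
  by move=> l /kmin + /allowedE; rewrite /= ua vc.
Qed.

(** The left side adds no point to the base, so the clause on new pairs is vacuous. *)
Lemma indep_trivial (X : set M) a c : X a -> indep S R [set a] X [set c].
Proof.
move=> Xa; split.
- move=> [u Du] [v Dv] uv; have [E|P [Puv Pu]] := @limit_complete u v.
    by apply: uv; exact: eq_sig_hprop.
  by exists P; split.
- by split; exact: embedding_inclusion.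
- move=> [d Dd]; right.
  have Cd : (X `|` [set c]) d by case: Dd => [[->|]|]; [left|left|right].
  by exists (exist _ d Cd) => //; exact: eq_sig_hprop.
- split=> [b|[u Au] [v Cv] [/= uv]]; first exact: eq_sig_hprop.
  have Xu : X u by case: Au => [->|].
  by exists (exist _ u Xu); split; exact: eq_sig_hprop.
- move=> [u Au] v uX; case: uX.
  have Xu : X u by case: Au => [->|].
  by exists (exist _ u Xu) => //; exact: eq_sig_hprop.
Qed.

Context (SR : prioritised_semifree S R).

(** Amalgamate [x] with [Z] over [X] and realise in [M] the type over X and Z that [x] acquires in
    the amalgam. *)
Lemma indep_realise X Z x : finite_set X -> finite_set Z -> ~ X x ->
  exists a, [/\ same_type X x a, ~ (X `|` Z) a &
    forall z, Z z -> ~ X z -> pindep X a z].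
Proof.
move=> Xfin Zfin Xx.
pose f := inclusion (@subsetUr M [set x] X).
pose h := inclusion (@subsetUl M X Z).
have Afin : finite_set ([set x] `|` X) by rewrite finite_setU.
have Cfin : finite_set (X `|` Z) by rewrite finite_setU.
have [D [i [j [[Dc [[_ iP] [_ jP]] _ [ij ijX] Did] [_ _ DS]]]]] :=
  SR.2 _ _ _ f h (Forbc_substructure Afin) (Forbc_substructure Xfin)
    (Forbc_substructure Cfin) (embedding_inclusion _) (embedding_inclusion _).
have lx : ([set x] `|` X) x by left.
pose x' : substructure ([set x] `|` X) := exist _ x lx.
(* [j] takes points bundled with a membership proof; quantifying over the proof makes [q] a relation
   on [M]. *)
pose q z P := exists Cz : (X `|` Z) z, edge P (i x') (j (exist _ z Cz)).
have qE z (Cz : (X `|` Z) z) P : q z P <-> edge P (i x') (j (exist _ z Cz)).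
  by split=> [[Cz']|]; [rewrite (Prop_irrelevance Cz Cz')|exists Cz].
have qX z P : X z -> q z P <-> edge P x z.
  move=> Xz; have -> : q z P = edge P (i x') (j (h (exist _ z Xz))).
    exact/propext/qE.
  by rewrite -ij -iP.
have [||a Xa aq] := @realise _ q Cfin.
- move=> z Cz; have [|P [Pz Pu]] := Dc (i x') (j (exist _ z Cz)).
    by move=> /ijX[[b Xb] [[E] _]]; rewrite E in Xx.
  by exists P; split; [exact/qE|move=> P' /(qE _ Cz)/Pu].
- move=> z z' P Q P' Cz Cz' /(qE _ Cz) Pz zz' /(qE _ Cz') Pz' PQP'.
  apply: (DS _ _ _ (triangles_swap12 (triangles_swap12 PQP'))).
  by exists (i x'), (j (exist _ z Cz)), (j (exist _ z' Cz')); split;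
    rewrite -?jP.
have xa : same_type X x a.
  by move=> z Xz P; rewrite aq ?qX//; left.
exists a; split=> // z Zz Xz.
have Cz : (X `|` Z) z by right.
have permE P : permitted X a z P <-> allowed S f h x' (exist _ z Cz) P.
  split=> [az [b Xb] Q Q' /(xa _ Xb)|xz b Q Q' Xb /(xa _ Xb)].
    exact: az.
  exact: xz (exist _ b Xb) Q Q'.
have [||k [kP kmin] xz] := Did x' (exist _ z Cz).
- by move=> [[b Xb] _ [E]]; rewrite E in Xb.
- by move=> [[b Xb] _ [E]]; rewrite E in Xb.
exists k; split; first exact/permE.
- by move=> l /kmin + /permE.
- by apply/(aq _ _ Cz)/qE.
Qed.


(** * Automorphisms meeting countably many dense requirements *)

Lemma back_and_forth (I : countType) (T : I -> set (M * M) -> Prop) :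
  (forall i s, finite_set s -> partial_iso s ->
    exists t, [/\ finite_set t, partial_iso t, s `<=` t & T i t]) ->
  exists h : aut M, forall i, exists2 s, s `<=` graph h & T i s.
Proof.
move=> Tdense; have [Mcount _ _] := MS.
have /countable_injP[phi phi_inj] := Mcount.
pose fiso := {s : set (M * M) | finite_set s /\ partial_iso s}.
(* Stage n meets the requirement with code n and puts the point with code n into domain and range;
   numbers that code nothing impose nothing. *)
have step (ns : nat * fiso) : exists t : fiso, [/\ sval ns.2 `<=` sval t,
    forall x, phi x = ns.1 ->
      (exists y, sval t (x, y)) /\ (exists y, sval t (y, x)) &
    forall i, unpickle ns.1 = Some i -> exists2 s, s `<=` sval t & T i s].
  case: ns => n [s [sfin sP]] /=.
  have [t [tfin tP st tT]] : exists t, [/\ finite_set t, partial_iso t,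
      s `<=` t & forall i, unpickle n = Some i -> T i t].
    case: (unpickle n) => [i|]; last by exists s; split.
    by have [t [? ? ? ?]] := Tdense i s sfin sP; exists t; split=> // _ [<-].
  have [[x xn]|nx] := pselect (exists x, phi x = n); last first.
    exists (exist _ t (conj tfin tP)); split=> //= [x xn|i /tT].
      by case: nx; exists x.
    by exists t.
  have [g tg] := homogeneity tfin tP.
  (* The new pairs come from an automorphism extending [t], so [t'] is again a partial
     isomorphism. *)
  pose t' := [set (x, g x); (aut_invfun g x, x)] `|` t.
  have t'fin : finite_set t'.
    by rewrite finite_setU; split=> //; exact: finite_set2.
  have t'P : partial_iso t'.
    by apply: (@partial_iso_graph g) => u [[->|->]|/tg //];
      rewrite /graph /= ?aut_invfunK.
  exists (exist _ t' (conj t'fin t'P)); split=> /=.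
  - by move=> u /st; right.
  - move=> y yx; have -> : y = x by apply: phi_inj; rewrite ?inE ?xn.
    by split; eexists; left; [left|right].
  - by move=> i /tT; exists t => // u; right.
have [F FP] := choice step.
have s0P : finite_set (set0 : set (M * M)) /\ @partial_iso set0 by split.
pose s := fix s n : fiso := if n is n'.+1 then F (n', s n')
  else exist _ set0 s0P.
have smono k l : k <= l -> sval (s k) `<=` sval (s l).
  move=> /subnKC <-; elim: (l - k) => [|n IH]; first by rewrite addn0.
  rewrite addnS /=; apply: subset_trans IH _.
  by have [] := FP (k + n, s (k + n)).
pose U u := exists k, sval (s k) u.
have UP : partial_iso U.
  move=> u v [k ku] [l lv]; have [_ sP] := svalP (s (maxn k l)).
  by apply: sP; [apply: smono ku; exact: leq_maxl|apply: smono lv;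
    exact: leq_maxr].
have Ufun x : (exists y, U (x, y)) /\ (exists y, U (y, x)).
  have [_ /(_ x erefl)[[y xy] [z zx]] _] := FP (phi x, s (phi x)).
  by split; [exists y|exists z]; exists (phi x).+1.
have [f fP] := choice (fun x => (Ufun x).1).
have [f' f'P] := choice (fun x => (Ufun x).2).
have Uinj u v : U u -> U v -> u.1 = v.1 <-> u.2 = v.2.
  move=> Uu Uv; split=> E; apply: contrapT => /edge_ex[P].
    by move=> /(UP _ _ Uu Uv); rewrite E; exact: edge_irr.
  by move=> /(UP _ _ Uu Uv); rewrite E; exact: edge_irr.
have fK : cancel f f' by move=> x; exact/(Uinj _ _ (f'P (f x)) (fP x)).
have f'K : cancel f' f by move=> x; exact/(Uinj _ _ (fP (f' x)) (f'P x)).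
exists (Aut fK f'K (fun P a b => iff_sym (UP _ _ (fP a) (fP b) P))) => i.
have [_ _ /(_ i)[|t tF iT]] := FP (pickle i, s (pickle i)).
  exact: pickleK.
exists t => // -[x y] /tF txy.
by apply/(Uinj _ _ (fP x)); [exists (pickle i).+1|].
Qed.

(** * Construction of the commutator *)

Definition escapes (T : L -> Prop) (g : aut M) :=
  forall Y y, finite_set Y -> ~ Y y ->
    exists2 b, same_type Y y b & exists2 Q, T Q & edge Q b (g b).

(* The properties linking [a], [e = g a] and [d = [h, g] a], where [D] is the
   domain of the finite approximation of [h] at which [a] is chosen. *)
Definition near_indep (T : L -> Prop) X x (a e d : M) := exists D : set M,
  [/\ [/\ finite_set D, X `<=` D, ~ (e |` D) a & ~ (e |` D) d],
      same_type X x a,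
      forall z, D z -> ~ X z -> free_edge a z,
      pindep (e |` D) d a &
      (exists2 Q, T Q & edge Q a e) /\ (exists2 Q, T Q & edge Q d e)].

(** One requirement of the construction: if the graph of [h] contains [t], then h maps g a to [b]
    and [d] to g^-1 b, so [h, g] a = d. *)
Lemma near_indep_step T g X x s : escapes T g -> finite_set X -> ~ X x ->
  finite_set s -> partial_iso s -> exists t a b d,
  [/\ finite_set t, partial_iso t, s `<=` t, t (g a, b) /\ t (d, aut_inv g b) &
      near_indep T X x a (g a) d].
Proof.
move=> gT Xfin Xx sfin sP.
have [f sf] := homogeneity sfin sP.
pose D := X `|` fst @` s.
have Dfin : finite_set D.
  by rewrite finite_setU; split=> //; exact: finite_image.
have gDfin : finite_set (aut_inv g @` D) by exact: finite_image.
pose fD := f @` D.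
have fDfin : finite_set fD by exact: finite_image.
have gfDfin : finite_set (g @` fD) by exact: finite_image.
have XD : X `<=` D by move=> ?; left.
have [|a0 [xa0 a0X a0free]] :=
    @indep_realise X (D `|` aut_inv g @` D) x Xfin _ Xx.
  by rewrite finite_setU.
(* Keeping the type over g^-1 D as well as over [D] puts g a outside [D], where its image may still
   be chosen. *)
have [||a a0a [Q TQ ae]] := gT (D `|` aut_inv g @` D) a0.
- by rewrite finite_setU.
- by move=> ?; apply: a0X; right.
have aD : ~ (D `|` aut_inv g @` D) a.
  by apply: same_type_notin a0a => ?; apply: a0X; right.
have eD : ~ D (g a).
  by move=> ?; apply: aD; right; exists (g a) => //=; rewrite aut_funK.
have feD : ~ fD (f (g a)).
  by move=> [u Du /(can_inj (aut_funK f)) ue]; apply: eD; rewrite -ue.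
(* The image of g a must have the type of f (g a) over f D. It is also kept out of g (f D), so that
   c = g^-1 b lies outside f D and its preimage is still free. *)
have [b0 [eb0 b0D _]] := indep_realise fDfin gfDfin feD.
have [|b b0b [Q' TQ' bgb]] := gT (fD `|` g @` fD) b0 _ b0D.
  by rewrite finite_setU.
have bD := same_type_notin b0D b0b.
pose c := aut_inv g b.
pose t0 := (fun u => (u, f u)) @` D.
pose t1 := (g a, b) |` t0.
have t0fin : finite_set t0 by exact: finite_image.
have t1fin : finite_set t1 by rewrite finite_setU.
have t1P : partial_iso t1.
  apply: partial_isoU; first by apply: (@partial_iso_graph f) => _ [u _ <-].
  move=> _ [u Du <-] P /=.
  have fDu : fD (f u) by exists u.
  by rewrite -b0b -?eb0 ?aut_edge//; left.
(* The preimage of [c] under [f1] gives the type over g a and [D] that [d] must have; [d] is then a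
   realisation of it independent from [a]. *)
have [f1 t1f1] := homogeneity t1fin t1P.
have f1e : f1 (g a) = b by apply: (t1f1 (g a, b)); left.
have f1D u : D u -> f1 u = f u.
  by move=> Du; apply: (t1f1 (u, f u)); right; exists u.
have cb : edge Q' c b by rewrite -(aut_edge g) /c /= aut_invfunK.
have d0D : ~ (g a |` D) (aut_inv f1 c).
  move=> d0; have : c = f1 (aut_inv f1 c) by rewrite /= aut_invfunK.
  case: d0 => [->|Du]; first by rewrite f1e; exact: edge_neq cb.
  rewrite (f1D _ Du) => cf; apply: bD; right; exists c; last first.
    by rewrite /c /= aut_invfunK.
  by rewrite cf; exists (aut_inv f1 c).
have [||d [d0d dD da]] := @indep_realise (g a |` D) [set a] _ _ _ d0D.
- by rewrite finite_setU.
- exact: finite_set1.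
have ane : a <> g a := edge_neq ae.
exists ((d, c) |` t1), a, b, d; split.
- by rewrite finite_setU; split.
- apply: partial_isoU => // u t1u P.
  have Du : (g a |` D) u.1 by case: t1u => [->|[v ? <-]]; [left|right].
  by rewrite -d0d// -(t1f1 _ t1u) -(aut_edge f1) /= aut_invfunK.
- move=> u su; right; right; exists u.1; first by right; exists u.
  by rewrite (sf _ su); case: u su.
- by split; [right; left|left].
- exists D; split.
  + split=> //; first by case=> [/ane//|?]; apply: aD; left.
    by move=> ?; apply: dD; left.
  + by apply: same_type_trans xa0 a0a => z /XD; left.
  + move=> z Dz Xz; have [|k kz] := pindep_free (a0free z _ Xz); first by left.
    by exists k; apply/a0a => //; left.
  + by apply: da => // -[/ane//|?]; apply: aD; left.
  + split; first by exists Q.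
    exists Q' => //; apply/d0d; first by left.
    (* r(d, e) = r(c, b) = r(g^-1 b, b) = r(b, g b). *)
    by rewrite -(aut_edge f1) /= aut_invfunK f1e.
Qed.

Lemma commutator_near_indep T g : escapes T g -> exists h : aut M,
  forall X x, finite_set X -> ~ X x ->
  exists a, near_indep T X x a (g a) (aut_comm h g a).
Proof.
move=> gT; have [Mcount _ _] := MS.
have /countable_injP[phi phi_inj] := Mcount.
(* A requirement is a pair (X, x), coded by the list of codes of the points of [X] and the code of
   [x]. *)
have [|h hP] := @back_and_forth (seq nat * nat)%type (fun i s =>
    let X := [set z | phi z \in i.1] in forall x, phi x = i.2 -> ~ X x ->
    exists a b d, [/\ s (g a, b), s (d, aut_inv g b) &
      near_indep T X x a (g a) d]).
  move=> [ns k] s sfin sP /=; set X := [set z | _].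
  have Xfin : finite_set X.
    by apply: finite_preimage (finite_seq ns) => y z _ _; apply: phi_inj;
      rewrite inE.
  have [[x [xk Xx]]|nx] := pselect (exists x, phi x = k /\ ~ X x); last first.
    by exists s; split=> // x xk Xx; case: nx; exists x.
  have [t [a [b [d [tfin tP st [tb td] ad]]]]] :=
    near_indep_step gT Xfin Xx sfin sP.
  exists t; split=> // y yk _; have -> : y = x.
    by apply: phi_inj; rewrite ?inE ?xk.
  by exists a, b, d.
exists h => X x Xfin Xx.
have /finite_seqP[ns nsE] : finite_set (phi @` X) by exact: finite_image.
have XE : [set z | phi z \in ns] = X.
  apply/seteqP; split=> z /=.
    have -> : is_true (phi z \in ns) = (phi @` X) (phi z) by rewrite nsE.
    by move=> [y Xy /phi_inj]; rewrite !inE => <-.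
  by move=> Xz; have : (phi @` X) (phi z) by [exists z]; rewrite nsE.
have Xns : ~ phi x \in ns by move=> xns; apply: Xx; rewrite -XE.
have [s sh] := hP (ns, phi x).
rewrite /= XE => /(_ x erefl Xns)[a [b [d [/sh /= hga /sh /= hd ad]]]].
exists a; move: hga hd; rewrite /graph /= => -> <-.
by rewrite aut_funK.
Qed.

(** * Removing points from the base *)

Context (star : condition_star S R M).

Lemma pindep_drop (B : set M) a b c : finite_set B ->
  ~ (b |` B) a -> ~ (b |` B) c -> free_edge a b ->
  pindep (b |` B) a c -> pindep B a c.
Proof.
move=> Bfin Ba Bc ab /(indepP Ba Bc) ac.
apply/indepP; first by move=> ?; apply: Ba; right.
  by move=> ?; apply: Bc; right.
apply: star.2 ac ab => // bc; apply: Bc; left.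
by rewrite bc.
Qed.

(** The points of D \ X are removed one at a time, each by clause (ii) of the condition. *)
Lemma pindep_shrink (X D : set M) a c : finite_set D -> X `<=` D ->
  ~ D a -> ~ D c -> (forall z, D z -> ~ X z -> free_edge a z) ->
  pindep D a c -> pindep X a c.
Proof.
move=> Dfin XD Da Dc Dfree ac; have Xfin := sub_finite_set XD Dfin.
have shrink E : finite_set E -> (forall z, E z -> D z /\ ~ X z) ->
    pindep (E `|` X) a c -> pindep X a c.
  elim/finite_set_rec=> [_|z A Afin IH zA]; first by rewrite set0U.
  have Afree u : A u -> D u /\ ~ X u by move=> Au; apply: zA; right.
  have [Dz Xz] : D z /\ ~ X z by apply: zA; left.
  have zAXD : z |` (A `|` X) `<=` D by move=> u [->//|[/Afree[]|/XD]].
  rewrite -setUA => azc; apply: IH => //; apply: (pindep_drop _ _ _ _ azc).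
  - by rewrite finite_setU.
  - by move/zAXD.
  - by move/zAXD.
  - exact: Dfree.
apply: (shrink (D `\` X)); first exact: finite_setD.
  by move=> z [].
by apply: pindepS ac => z Dz; have [|] := pselect (X z); [right|left].
Qed.

Lemma near_indep_free T X x a e d : near_indep T X x a e d -> free_edge a d.
Proof. by case=> D [_ _ _ /pindep_sym/pindep_free]. Qed.

Lemma near_indep_pindep X x a e d :
  near_indep [set R k | k in setT] X x a e d -> pindep X a d.
Proof.
case=> D [[Dfin XD Da Dd] xa Dfree da [_ [_ [k _ <-] de]]].
apply: (pindep_shrink Dfin XD _ _ Dfree).
- by move=> ?; apply: Da; right.
- by move=> ?; apply: Dd; right.
(* The point [e] is removed from the side of [d], using r(d, e) in L'; the rest of D \ X from the
   side of [a]. *)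
- by apply/pindep_sym/(pindep_drop Dfin Dd Da _ da); exists k.
Qed.

Lemma near_indep_same_type T X x a e d :
  near_indep T X x a e d -> same_type X x a.
Proof. by case=> D []. Qed.

(** * Every non-trivial automorphism moves a realisation of each type *)

Section Nontrivial.
Context (Rinj : injective R) (Rproper : range R `<` [set: L]).

(* [P2] is R_2, or any relation outside L' when L' = {R_1}. *)
Lemma generic_colours (x : M) : exists P1 P2, [/\ P1 <> P2,
  forall Q, ~ S P1 P1 Q & forall Q, ~ S P1 P2 Q].
Proof.
(* L' is non-empty: a point independent from [x] over the empty set is related to it by some
   [R k]. *)
have [_ [_ _ /(_ x erefl) [//|k _]]] :=
  @indep_realise set0 [set x] x (finite_set0 M) (finite_set1 x) id.
have m0 : 0 < m by exact: leq_ltn_trans (ltn_ord k).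
pose k0 := Ordinal m0.
have [m1|m1] := ltnP 1 m.
  exists (R k0), (R (Ordinal m1)); split; first by move=> /Rinj[].
    by move=> Q; apply: star.1.
  by move=> Q; apply: star.1.
have Rk0 l : l = k0 by apply: val_inj; case: l => -[|l] //= /leq_trans /(_ m1).
have [P2 P2R] : exists P, ~ range R P.
  by apply: contrapT => /forallNP RT; apply: Rproper.2 => P _; exact: contrapT.
exists (R k0), P2; split.
- by move=> E; apply: P2R; exists k0.
- by move=> Q; apply: star.1.
move=> Q PQ.
have over1 P : exists2 y, y <> x & edge P y x.
  have [||y yx yP] := @realise [set x] (fun _ P' => P' = P) (finite_set1 x).
  - by move=> z _; exists P; split.
  - by move=> z z' P' U P'' -> -> _ E; case: (edge_irr E).
  by exists y => //; apply/yP.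
have [y yx Pyx] := over1 P2; have [z zx Qzx] := over1 Q.
(* With r(y, x) = P2 and r(x, z) = Q, independence over x forces the only relation of L', namely
   R_1, to be permitted, so P2, Q, R_1 is not in [S]. *)
have [a [ya _ /(_ z erefl zx)[l [lperm _ _]]]] :=
  @indep_realise [set x] [set z] y (finite_set1 x) (finite_set1 z) yx.
apply: (lperm x P2 Q); rewrite //; first exact/(ya x erefl).
  exact: edge_sym.
by rewrite (Rk0 l); exact/triangles_swap23/triangles_swap12.
Qed.

Context (g : aut M) (gnontriv : exists x, g x <> x).

(** If r(a, y) = P1 and r(a, g y) = P2, then [g] moves [a]. Such relations can be added to the type
    of [x] over [X] once [y] is moved and both [y] and g y are related to all of [X] by P1: every
    new triangle then has edges P1, P1 or P1, P2. *)
Lemma nontrivial_escapes : escapes setT g.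
Proof.
have [y0 gy0] := gnontriv.
have [P1 [P2 [P12 S11 S12]]] := generic_colours y0.
have generic (Y : set M) w : finite_set Y -> exists2 a, ~ Y a &
    forall z P, Y z -> edge P a z <-> (P = if pselect (z = w) then P2 else P1).
  move=> Yfin; apply: realise => // [z _|z z' P Q P' _ _ -> zz' ->].
    by eexists; split; [reflexivity|].
  move: zz'; case: pselect => zw; case: pselect => zw' zz' /=.
  - by rewrite zw zw' in zz'; case: (edge_irr zz').
  - by move=> E; exact: S12 _ (triangles_swap12 (triangles_swap23 E)).
  - by move=> E; exact: S12 _ (triangles_swap23 E).
  - by move=> E; exact: S11 _ (triangles_swap23 E).
have moved a y : edge P1 a y -> edge P2 a (g y) -> g a <> a.
  by move=> /(aut_edge g) + ay ga; rewrite ga => /edge_inj/(_ ay).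
have far Z : finite_set Z -> exists2 y, ~ Z y & g y <> y.
  move=> Zfin; have [|a aZ aP] := generic (Z `|` [set y0; g y0]) (g y0).
    by rewrite finite_setU; split=> //; exact: finite_set2.
  exists a; first by move=> ?; apply: aZ; left.
  apply: (@moved a y0); apply/aP; try by [right; left|right; right].
    by case: pselect => // y0g; case: gy0.
  by case: pselect.
have free Z : finite_set Z -> exists y, g y <> y /\
    forall z, Z z -> edge P1 y z /\ edge P1 (g y) z.
  (* r(g y, z) = r(y, g^-1 z), so it suffices that [y] is related by P1 to all of [W]. To be moved
     as well, [y] gets P1 to [w] and P2 to g w, for a moved [w] with g w outside [W]. *)
  move=> Zfin; pose W := Z `|` aut_inv g @` Z.
  have Wfin : finite_set W.
    by rewrite finite_setU; split=> //; exact: finite_image.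
  have [|w wW gw] := far (aut_inv g @` W); first exact: finite_image.
  have gwW : ~ W (g w).
    by move=> ?; apply: wW; exists (g w) => //=; rewrite aut_funK.
  have [|y yW yP] := generic (W `|` [set w; g w]) (g w).
    by rewrite finite_setU; split=> //; exact: finite_set2.
  have yP1 z : W z -> edge P1 y z.
    move=> Wz; apply/yP; first by left.
    by case: pselect => // zw; case: gwW; rewrite -zw.
  exists y; split.
    apply: (@moved y w); apply/yP; try by [right; left|right; right].
      by case: pselect => // wg; case: gw.
    by case: pselect.
  move=> z Zz; split; first by apply: yP1; left.
  rewrite -(aut_invfunK g z) aut_edge; apply: yP1; right.
  by exists z.
move=> X x Xfin Xx; have [y [gy yX]] := free X Xfin.
have Xy : ~ X y by move=> /yX[E _]; exact: edge_irr E.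
have Xgy : ~ X (g y) by move=> /yX[_ E]; exact: edge_irr E.
pose q z P := [\/ X z /\ edge P x z, z = y /\ P = P1 | z = g y /\ P = P2].
have [|||a aX aP] := @realise (X `|` [set y; g y]) q.
- by rewrite finite_setU; split=> //; exact: finite_set2.
- move=> z [Xz|[->|->]].
  + have [|P xz] := @edge_ex x z; first by move=> E; rewrite E in Xx.
    exists P; split; first exact: Or31.
    move=> P' [[_ xz']|[zy]|[zy]]; first exact: edge_inj xz xz'.
      by case: Xy; rewrite -zy.
    by case: Xgy; rewrite -zy.
  + exists P1; split; first exact: Or32.
    by move=> P' [[//]|[_ ->//]|[/esym//]].
  + exists P2; split; first exact: Or33.
    by move=> P' [[//]|[//]|[_ ->//]].
- move=> z z' P Q P' _ _ [[Xz xz]|[? ?]|[? ?]] + [[Xz' xz']|[? ?]|[? ?]]; subst.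
  + by move=> zz'; exact: limit_triangle xz zz' xz'.
  + have [yz _] := yX _ Xz.
    move=> zQ; rewrite -(edge_inj yz (edge_sym zQ)) => E.
    exact: S11 _ (triangles_swap23 (triangles_swap12 E)).
  + have [_ gyz] := yX _ Xz.
    move=> zQ; rewrite -(edge_inj gyz (edge_sym zQ)) => E.
    exact: S12 _ (triangles_swap23 (triangles_swap12 E)).
  + have [yz _] := yX _ Xz'.
    by move=> zQ; rewrite -(edge_inj yz zQ); exact: S11.
  + by move=> E; case: (edge_irr E).
  + by move=> _ E; exact: S12 _ (triangles_swap23 E).
  + have [_ gyz] := yX _ Xz'.
    by move=> zQ; rewrite -(edge_inj gyz zQ) => E;
      exact: S12 _ (triangles_swap12 E).
  + by move=> _ E; exact: S12 _ (triangles_swap12 (triangles_swap23 E)).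
  + by move=> E; case: (edge_irr E).
have ga : g a <> a.
  apply: (@moved a y); apply/aP; try by [right; left|right; right].
    exact: Or32.
  exact: Or33.
exists a.
  move=> z Xz P; rewrite aP; last by left.
  split=> [|[[]|[zy]|[zy]]//]; first by move=> ?; apply: Or31.
    by case: Xy; rewrite -zy.
  by case: Xgy; rewrite -zy.
by have [|Q aga] := @edge_ex a (g a); [exact/nesym|exists Q].
Qed.

End Nontrivial.

End Independence.
End Structures.

(** * Two rounds of commutators *)

Theorem theorem5p3 (L : Type) (S : triangles L) (m : nat) (R : 'I_m -> L)
    (M : structure L) :
  injective R -> range R `<` [set: L] ->
  prioritised_semifree S R ->
  fraisse_limit (Forbc S) M ->
  condition_star S R M ->
  forall g : aut M, (exists x, g x <> x) ->
  exists k h : aut M,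
    moves_almost_maximally S R (aut_comm k (aut_comm h g)).
Proof.
move=> Rinj Rproper SR MS star g gnontriv.
have [h hP] := commutator_near_indep MS SR
  (nontrivial_escapes MS SR star Rinj Rproper gnontriv).
(* The first round yields only r(a, [h, g] a) in L', which is the input that the second round
   needs. *)
have hesc : escapes (range R) (aut_comm h g).
  move=> Y y Yfin Yy; have [a ad] := hP Y y Yfin Yy.
  exists a; first exact: near_indep_same_type ad.
  by have [k kad] := near_indep_free ad; exists (R k) => //; exists k.
have [k kP] := commutator_near_indep MS SR hesc.
exists k, h => X p Xfin [x ->].
have [Xx|Xx] := pselect (X x).
  exists x; last exact: (indep_trivial MS).
  have [//|f fX fx] := @same_type_aut _ _ _ MS X x x Xfin.
  by exists f.
have [a ad] := kP X x Xfin Xx.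
have xa := near_indep_same_type ad.
have [f fX fx] := same_type_aut MS Xfin xa.
exists a; first by exists f.
apply/(indepP MS); first exact: (same_type_notin MS Xx xa).
  by case: ad => D [[_ XD _ Dd] _ _ _ _]; move=> /XD ?; apply: Dd; right.
exact: (near_indep_pindep MS star ad).
Qed.
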